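(* Let $V$ be a countable discrete set, let $(\Omega,\mathscr{F},P)$ be a probability space, and let $(\varphi_x)_{x\in V}$ be a random frame in $\mathscr{H}=L^2(\Omega,P)$ whose linear span is dense in $\mathscr{H}$. Let $L$ be the densely defined operator with domain $\mathrm{span}\{\varphi_x\}_{x\in V}$ given by $Lf=(\mathbb{E}(\varphi_x f))_{x\in V}\in l^2(V)$, and let $L_1=\overline{L}$ be its closure. Then: (1) The generalized frame operator $$L^*L_1 f=\sum_{x\in V}\mathbb{E}(\varphi_x f)\,\varphi_x$$ is selfadjoint in $L^2(\Omega,P)$ (generally unbounded). (2) Let $a,b\in\mathbb{R}_+$ satisfy $0<a\le b<\infty$, and set $\alpha=[a,b]$. Let $P_E(\cdot)$ be the projection valued measure (spectral resolution) of $L^*L_1$, and let $\mathscr{H}(\alpha)=P_E(\alpha)\mathscr{H}$. Then $$a\,\mathbb{E}(|f|^2)\le\sum_{x\in V}\left|\mathbb{E}(\varphi_x f)\right|^2\le b\,\mathbb{E}(|f|^2)$$ holds for all $f\in\mathscr{H}(\alpha)$.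
   Context: $L^2(\Omega,P)$ is the Hilbert space of real-valued random variables $f:\Omega\to\mathbb{R}$, measurable, with $\mathbb{E}(|f|^2)=\int_\Omega|f|^2\,dP<\infty$, and inner product $\langle f,g\rangle=\mathbb{E}(fg)$. A system $(\varphi_x)_{x\in V}\subset L^2(\Omega,P)$ is a random frame if (i) $\sum_{y\in V}|\mathbb{E}(\varphi_x\varphi_y)|^2<\infty$ for all $x\in V$, and (ii) whenever $(c_x)\in l^2(V)$ satisfies $\sum_{y\in V}\mathbb{E}(\varphi_x\varphi_y)c_y=-c_x$ for all $x\in V$, then $(c_x)=0$ in $l^2(V)$. $L^*:l^2(V)\to L^2(\Omega,P)$ denotes the (possibly unbounded) adjoint of $L$, and $L^*L_1$ has its natural domain $\{f\in dom(L_1): L_1f\in dom(L^* )\}$.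
   Formalization: The series for L*L_1 f is taken weakly: for every h in dom(L_1), the sum of E(φ_x f)E(φ_x h) converges absolutely to E(h·L*L_1 f), because convergence of the series in the L^2 norm, or weakly against all of L^2, can fail for a random frame. *)

(* Defs.v *)
From HB Require Import structures.
From mathcomp Require Import all_boot all_order all_algebra.
From mathcomp Require Import ring.
From mathcomp Require Import all_classical all_reals all_analysis.

Set Implicit Arguments.
Unset Strict Implicit.
Unset Printing Implicit Defensive.
Import Order.TTheory GRing.Theory Num.Theory.
Import numFieldNormedType.Exports.
Local Open Scope classical_set_scope.
Local Open Scope ring_scope.

(* Sum of an absolutely summable real family over an arbitrary index set; every
   sum of signed terms below is absolutely summable. *)
Definition rsum {R : realType} {V : choiceType} (a : V -> R) : R :=
  (fine (\esum_(x in [set: V]) (Num.max (a x) 0)%:E)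
   - fine (\esum_(x in [set: V]) (Num.max (- a x) 0)%:E))%R.

Definition l2_pred {R : realType} {V : choiceType} : {pred V -> R} :=
  mem [set c : V -> R | (\esum_(x in [set: V]) (`|c x| ^+ 2)%:E < +oo)%E].

Lemma l2_pred_submod_closed {R : realType} {V : choiceType} :
  submod_closed (@l2_pred R V).
Proof.
split=> [|k u v].
  rewrite inE/= esum1 ?ltry// => x _.
  by rewrite -[(0 : V -> R) x]/(0 : R) normr0 expr0n.
rewrite !inE/= => u2 v2.
set U := (\esum_(x in [set: V]) (`|u x| ^+ 2)%:E)%E in u2.
set W := (\esum_(x in [set: V]) (`|v x| ^+ 2)%:E)%E in v2.
pose M : R := 2 * k ^+ 2 * fine U + 2 * fine W.
have fs : forall (w : V -> R) F, fsets [set: V] F ->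
    (\esum_(x in [set: V]) (`|w x| ^+ 2)%:E < +oo)%E ->
    (\sum_(x \in F) `|w x| ^+ 2 <= fine (\esum_(x in [set: V]) (`|w x| ^+ 2)%:E))%R.
  move=> w F FV wy; rewrite -lee_fin fineK; last first.
    by rewrite ge0_fin_numE// esum_ge0// => x _; rewrite lee_fin exprn_ge0.
  rewrite -fsumEFin; last exact: FV.1.
  by apply: ereal_sup_ubound; exists F.
apply: (@le_lt_trans _ _ M%:E); last exact: ltry.
apply: ge_ereal_sup => _ [F FV <-].
rewrite fsumEFin; last exact: FV.1.
rewrite lee_fin.
apply: (@le_trans _ _ (2 * k ^+ 2 * (\sum_(x \in F) `|u x| ^+ 2)
                       + 2 * (\sum_(x \in F) `|v x| ^+ 2))).
  rewrite !fsbig_finite /=; try exact: FV.1.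
  rewrite !mulr_sumr -big_split/=; apply: ler_sum => x _.
  rewrite !real_normK ?num_real//.
  rewrite -[(k *: u + v) x]/(k * u x + v x).
  rewrite -subr_ge0 (_ : _ - _ = (k * u x - v x) ^+ 2) ?sqr_ge0//.
  by rewrite sqrrD sqrrB exprMn !mulr_natl -!mulrA !mulr2n !mulrDl; ring.
apply: lerD; apply: ler_wpM2l => //.
- by rewrite mulr_ge0// sqr_ge0.
- exact: (fs u F).
- exact: (fs v F).
Qed.

Record l2 (R : realType) (V : choiceType) :=
  L2 { l2_val :> V -> R ; l2_valP : l2_val \in l2_pred }.

HB.instance Definition _ (R : realType) (V : choiceType) :=
  [isSub of l2 R V for @l2_val R V].
HB.instance Definition _ (R : realType) (V : choiceType) :=
  [Choice of l2 R V by <:].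
HB.instance Definition _ (R : realType) (V : choiceType) :=
  GRing.isSubmodClosed.Build R (V -> R) l2_pred (@l2_pred_submod_closed R V).
HB.instance Definition _ (R : realType) (V : choiceType) :=
  [SubChoice_isSubLmodule of l2 R V by <:].

Definition l2_ip {R : realType} {V : choiceType} (c e : l2 R V) : R :=
  rsum (fun x => c x * e x).

(* The elements of L2(Omega, P) are kept as square-integrable random variables:
   [L2_ip] is positive semidefinite and its null vectors are the random
   variables that vanish almost surely. Two random variables are the same
   element of the Hilbert space when they are related by [heq L2_ip]. *)
Notation L2rv P := (LfunType P (lee1n 2)).

Definition L2_ip {d : measure_display} {Omega : measurableType d}
    {R : realType} (P : probability Omega R) (f g : L2rv P) : R :=
  fine 'E_P[(fun w => f w * g w)%R].

Definition normsq {R : realType} {H : lmodType R} (ip : H -> H -> R) (f : H) : R :=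
  ip f f.

Definition heq {R : realType} {H : lmodType R} (ip : H -> H -> R) (f g : H) : Prop :=
  normsq ip (f - g) = 0.

Definition dense_in {R : realType} {H : lmodType R} (ip : H -> H -> R)
    (D : set H) : Prop :=
  forall (f : H) (e : R), 0 < e -> exists2 g, D g & normsq ip (f - g) < e.

Definition lspan {R : realType} {H : lmodType R} (ip : H -> H -> R)
    {V : choiceType} (phi : V -> H) : set H :=
  [set f | exists (s : seq V) (a : V -> R), heq ip f (\sum_(x <- s) a x *: phi x)].

(* An unbounded operator from H to K is given by its graph, a set of pairs;
   composition of graphs is the relational [S \; T], the graph of
   f |-> S (T f) on its natural domain {f in dom T | T f in dom S}. *)
Definition odom {R : realType} {H K : lmodType R} (T : set (H * K)) : set H :=
  [set f | exists g, T (f, g)].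

Definition oclosure {R : realType} {H K : lmodType R} (ipH : H -> H -> R)
    (ipK : K -> K -> R) (T : set (H * K)) : set (H * K) :=
  [set p | forall e : R, 0 < e -> exists2 q, T q &
    normsq ipH (p.1 - q.1) < e /\ normsq ipK (p.2 - q.2) < e].

Definition oadjoint {R : realType} {H K : lmodType R} (ipH : H -> H -> R)
    (ipK : K -> K -> R) (T : set (H * K)) : set (K * H) :=
  [set p | forall f g, T (f, g) -> ipK g p.1 = ipH f p.2].

Definition selfadjoint {R : realType} {H : lmodType R} (ip : H -> H -> R)
    (T : set (H * H)) : Prop :=
  dense_in ip (odom T) /\ oadjoint ip ip T = T.

(* Projection valued measure on the Borel sets of the real line. A map that is
   symmetric and idempotent up to [heq] is an orthogonal projection (linearity
   follows from symmetry). Countable additivity is the requirement that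
   A |-> <E A f, f> be the restriction to Borel sets of a measure. *)
Record pvm (R : realType) (H : lmodType R) (ip : H -> H -> R) := PVM {
  pvm_proj :> set R -> H -> H ;
  pvm_sym : forall A f g, @measurable _ (measurableTypeR R) A ->
    ip (pvm_proj A f) g = ip f (pvm_proj A g) ;
  pvm_setI : forall A B f, @measurable _ (measurableTypeR R) A ->
    @measurable _ (measurableTypeR R) B ->
    heq ip (pvm_proj A (pvm_proj B f)) (pvm_proj (A `&` B) f) ;
  pvm_setT : forall f, heq ip (pvm_proj [set: R] f) f ;
  pvm_measure : H -> {measure set (measurableTypeR R) -> \bar R} ;
  pvm_measureE : forall f A, @measurable _ (measurableTypeR R) A ->
    pvm_measure f A = (ip (pvm_proj A f) f)%:E
}.

(* T is the integral of the identity function against E: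
   dom T = {f | int t^2 d<E f, f> < oo} and <T f, h> = int t d<E f, h>, where the
   signed measure <E f, h> is obtained by polarization. *)
Definition spectral_resolution {R : realType} {H : lmodType R}
    (ip : H -> H -> R) (T : set (H * H)) (E : pvm ip) : Prop :=
  (forall f, odom T f <->
    (\int[pvm_measure E f]_t (t ^+ 2)%:E < +oo)%E) /\
  (forall f g h, T (f, g) -> odom T h ->
    (ip g h)%:E = (4^-1)%:E * (\int[pvm_measure E (f + h)]_t t%:E
                               - \int[pvm_measure E (f - h)]_t t%:E))%E.

Definition spectral_subspace {R : realType} {H : lmodType R} (ip : H -> H -> R)
    (E : pvm ip) (A : set R) : set H :=
  [set f | exists h, heq ip f (E A h)].

Definition random_frame {d : measure_display} {Omega : measurableType d}
    {R : realType} (P : probability Omega R) {V : choiceType}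
    (phi : V -> L2rv P) : Prop :=
  (forall x, (\esum_(y in [set: V]) (`|L2_ip (phi x) (phi y)| ^+ 2)%:E < +oo)%E) /\
  (forall c : l2 R V,
    (forall x, rsum (fun y => L2_ip (phi x) (phi y) * c y) = - c x) -> c = 0).

Definition analysis_op {d : measure_display} {Omega : measurableType d}
    {R : realType} (P : probability Omega R) {V : choiceType}
    (phi : V -> L2rv P) : set (L2rv P * l2 R V) :=
  [set p : L2rv P * l2 R V | lspan (@L2_ip _ _ _ P) phi p.1 /\
           forall x, p.2 x = L2_ip (phi x) p.1].

(* g is the sum of the c x *: phi x, tested against every h in the subspace D.
   For the generalized frame operator D is dom L1. Norm convergence of the series
   fails in general, even under the random frame condition: with e_n orthonormal,
   phi_0 = e_0, phi_n = n(e_n - e_(n-1)), and f in the domain of L^* L1 such that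
   <phi_n, f> = 1/n for n > 0, the partial sums differ from a constant by e_N. *)
Definition weak_sum {R : realType} {H : lmodType R} (ip : H -> H -> R)
    {V : choiceType} (D : set H) (c : V -> R) (phi : V -> H) (g : H) : Prop :=
  forall h, D h ->
    summable [set: V] (fun x => (c x * ip (phi x) h)%:E) /\
    ip g h = rsum (fun x => c x * ip (phi x) h).

(* Main.v *)
Require Import Defs.
From mathcomp Require Import all_boot all_order all_algebra.
From mathcomp Require Import ring lra finmap.
From mathcomp Require Import all_classical all_reals all_analysis.
From mathcomp Require Import measurable_realfun.

Import Order.TTheory GRing.Theory Num.Theory.
Import numFieldNormedType.Exports.
Local Open Scope classical_set_scope.
Local Open Scope ring_scope.

Set Implicit Arguments.
Unset Strict Implicit.
Unset Printing Implicit Defensive.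

(* Von Neumann's theorem: if T is a closed densely defined operator between
   Hilbert spaces, projecting (h, 0) onto the graph of T shows that
   1 + T^* T is onto, and this together with symmetry makes T^* T selfadjoint.
   Here it is applied to the closure L1 of the analysis operator, which still
   maps f to the family of the E(phi_x f).

   For the frame bounds, the measure <E(.) f, f> of a vector f of the range of
   E [a, b] is carried by [a, b] and has mass |f|^2. Hence f is in the domain of
   L^* L1, and the sum of the |E(phi_x f)|^2, which is |L1 f|^2 = <L^* L1 f, f>,
   is the integral of t against that measure. *)

(** * Numerical estimates and limits *)

(** For inner products that vanish by approximation: Cauchy-Schwarz bounds their squares by a small
    [e] times a fixed [M]. *)
Lemma sqr_eps0 (R : realType) (x M : R) :
  (forall e, 0 < e -> x ^+ 2 <= e * M) -> x = 0.
Proof.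
move=> xM; apply/eqP; rewrite -sqrf_eq0 eq_le sqr_ge0 andbT.
apply/ler_addgt0Pl => e e0; rewrite addr0.
have M1 : 0 < `|M| + 1 by rewrite ltr_wpDl.
apply: (le_trans (xM (e / (`|M| + 1)) _)); first by rewrite divr_gt0.
rewrite mulrAC ler_pdivrMr// ler_pM2l//.
by rewrite (le_trans (ler_norm M))// lerDl.
Qed.

(** The rate of [ip_complete] is 4^-n up to a constant [C]; one index has to make both the rate and
    its multiple small. *)
Lemma expr4V_lt (R : realType) (C e : R) : 0 < e ->
  exists2 n, (4^-1 : R) ^+ n < e & C * 4^-1 ^+ n < e.
Proof.
move=> e0; have M1 : 0 < `|C| + 1 by rewrite ltr_wpDl.
have : (fun n => (4^-1 : R) ^+ n) @ \oo --> (0 : R).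
  by apply: cvg_expr; rewrite ger0_norm ?invr_ge0// invf_lt1 ?ltr1n.
move/cvgrPdist_lt => /(_ (e / (`|C| + 1))) []; first by rewrite divr_gt0.
move=> n _ /(_ n (leqnn n)); rewrite sub0r normrN.
rewrite ger0_norm ?exprn_ge0 ?invr_ge0//.
rewrite ltr_pdivlMr// => ne; exists n.
  by apply: le_lt_trans ne; rewrite ler_peMr ?exprn_ge0 ?invr_ge0// lerDr.
apply: le_lt_trans ne; rewrite mulrC ler_wpM2l ?exprn_ge0 ?invr_ge0//.
by rewrite (le_trans (ler_norm _))// lerDl.
Qed.

Lemma fast_cauchy_cvg (R : realType) (a : nat -> R) :
  (forall n m, (n <= m)%N -> (a m - a n) ^+ 2 <= 4^-1 ^+ n) -> cvgn a.
Proof.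
move=> aC; apply: cauchy_cvg; apply/cauchy_exP => e e0.
have [n ne _] := expr4V_lt 0 (exprn_gt0 2 e0).
exists (a n); exists n => //= m /= nm.
rewrite /ball/= distrC -(@ltr_pXn2r _ 2)// ?nnegrE ?ltW//.
rewrite real_normK ?num_real//.
exact: le_lt_trans (aC _ _ nm) ne.
Qed.

Lemma limn_einf_le (R : realType) (v : (\bar R)^nat) (M : \bar R) :
  (forall n, v n <= M)%E -> (limn_einf v <= M)%E.
Proof.
move=> vM; rewrite limn_einf_lim; apply: lime_le; first exact: is_cvg_einfs.
apply: nearW => n; apply: le_trans (vM n).
by apply: ereal_inf_lbound; exists n => /=.
Qed.

(** * Semi-inner product spaces *)

Section semi_inner_product.
Context {R : realType}.

(** Definiteness is left out because almost surely equal random variables remain distinct elements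
    of [L2rv P]. *)
Record semi_ip (H : lmodType R) (ip : H -> H -> R) : Prop := SemiIp {
  ipC : forall f g, ip f g = ip g f ;
  ipPl : forall k f g h, ip (k *: f + g) h = k * ip f h + ip g h ;
  ip_ge0 : forall f, 0 <= ip f f }.

(* A Cauchy sequence has a subsequence with this rate, so this is the usual
   completeness. *)
Definition ip_complete (H : lmodType R) (ip : H -> H -> R) : Prop :=
  forall u : nat -> H,
    (forall n m, (n <= m)%N -> normsq ip (u m - u n) <= 4^-1 ^+ n) ->
    exists l C, forall n, normsq ip (u n - l) <= C * 4^-1 ^+ n.

Definition lin_subspace (H : lmodType R) (D : set H) : Prop :=
  D 0 /\ forall k f g, D f -> D g -> D (k *: f + g).

Section theory.
Context {H : lmodType R} {ip : H -> H -> R} (ipP : semi_ip ip).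

Lemma ip0l g : ip 0 g = 0.
Proof. by have := ipPl ipP (-1) 0 0 g; rewrite scaler0 addr0 => e; lra. Qed.

Lemma ipZl k f g : ip (k *: f) g = k * ip f g.
Proof. by rewrite -[k *: f]addr0 (ipPl ipP) ip0l addr0. Qed.

Lemma ipDl f g h : ip (f + g) h = ip f h + ip g h.
Proof. by rewrite -[f]scale1r (ipPl ipP) mul1r scale1r. Qed.

Lemma ipBl f g h : ip (f - g) h = ip f h - ip g h.
Proof. by rewrite ipDl -scaleN1r ipZl mulN1r. Qed.

Lemma ipDr f g h : ip f (g + h) = ip f g + ip f h.
Proof. by rewrite !(ipC ipP f) ipDl. Qed.

Lemma ipBr f g h : ip f (g - h) = ip f g - ip f h.
Proof. by rewrite !(ipC ipP f) ipBl. Qed.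

Lemma ipZr k f g : ip f (k *: g) = k * ip f g.
Proof. by rewrite !(ipC ipP f) ipZl. Qed.

Lemma ip_sum (V : Type) (s : seq V) (F : V -> H) h :
  ip (\sum_(x <- s) F x) h = \sum_(x <- s) ip (F x) h.
Proof.
elim: s => [|x s ih]; first by rewrite !big_nil ip0l.
by rewrite !big_cons ipDl ih.
Qed.

Lemma ip_cs f g : ip f g ^+ 2 <= normsq ip f * normsq ip g.
Proof.
rewrite /normsq.
have q t : 0 <= ip f f - 2 * t * ip f g + t ^+ 2 * ip g g.
  have := ip_ge0 ipP (f - t *: g).
  by rewrite !ipBl !ipBr !ipZl !ipZr (ipC ipP g f) => h; lra.
have [g0|g0] := eqVneq (ip g g) 0.
  rewrite g0 mulr0; have [->|fg] := eqVneq (ip f g) 0; first by rewrite expr0n.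
  (* For null [g] the quadratic [q] is affine in [t] with nonzero slope, and this [t] brings it to
     -1. *)
  have := q ((ip f f + 1) / (2 * ip f g)).
  have -> : 2 * ((ip f f + 1) / (2 * ip f g)) * ip f g = ip f f + 1 by field.
  by rewrite g0 mulr0 => h; lra.
have g1 : 0 < ip g g by rewrite lt_neqAle eq_sym g0 (ip_ge0 ipP).
(* The minimizer of the quadratic. *)
have := q (ip f g / ip g g).
have -> : ip f f - 2 * (ip f g / ip g g) * ip f g +
     (ip f g / ip g g) ^+ 2 * ip g g
   = (ip f f * ip g g - ip f g ^+ 2) / ip g g by field.
by rewrite pmulr_lge0 ?invr_gt0// subr_ge0.
Qed.

Lemma normsq_ge0 f : 0 <= normsq ip f.
Proof. exact: ip_ge0. Qed.

Lemma normsq_eq0 f g : normsq ip f = 0 -> ip f g = 0.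
Proof.
move=> f0; apply/eqP; rewrite -sqrf_eq0 eq_le sqr_ge0 andbT.
by have := ip_cs f g; rewrite f0 mul0r.
Qed.

Lemma heq_ip f g h : heq ip f g -> ip f h = ip g h.
Proof. by move=> /normsq_eq0 => /(_ h); rewrite ipBl => /subr0_eq. Qed.

Lemma heq_lin k f f' g g' : heq ip f f' -> heq ip g g' ->
  heq ip (k *: f + g) (k *: f' + g').
Proof.
rewrite /heq => f0 g0.
have -> : k *: f + g - (k *: f' + g') = k *: (f - f') + (g - g').
  by rewrite scalerBr opprD addrACA.
by rewrite /normsq (ipPl ipP) (normsq_eq0 _ f0) (normsq_eq0 _ g0) mulr0 addr0.
Qed.

Lemma heq_normsq f g : heq ip f g -> normsq ip f = normsq ip g.
Proof. by move=> fg; rewrite /normsq (heq_ip _ fg) (ipC ipP) (heq_ip _ fg). Qed.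

Lemma normsqD_le f g : normsq ip (f + g) <= 2 * normsq ip f + 2 * normsq ip g.
Proof.
have := ip_ge0 ipP (f - g).
by rewrite /normsq !ipBl !ipBr !ipDl !ipDr (ipC ipP g f) => h; lra.
Qed.

Lemma normsqB f g : normsq ip (f - g) = normsq ip (g - f).
Proof. by rewrite /normsq !ipBl !ipBr (ipC ipP g f); ring. Qed.

(** For [g] in [D] close to [f], the squared norm of [f] equals [ip (f - g) f], which Cauchy-Schwarz
    makes small. *)
Lemma dense_orth (D : set H) f : dense_in ip D ->
  (forall g, D g -> ip f g = 0) -> normsq ip f = 0.
Proof.
move=> dD fD; apply: (@sqr_eps0 _ _ (normsq ip f)) => e e0.
have [g Dg fg] := dD f e e0.
have {1}-> : normsq ip f = ip (f - g) f.
  by rewrite ipBl (ipC ipP g) (fD g Dg) subr0.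
apply: (le_trans (ip_cs _ _)); apply: ler_wpM2r; first exact: ip_ge0.
exact: ltW.
Qed.

(** A minimizing sequence for the distance from [f] to [D] converges by the parallelogram law. As
    [D] need not be closed, the limit [p] is only a limit of elements of [D]. *)
Lemma projection (D : set H) : lin_subspace D -> ip_complete ip -> forall f,
  exists2 p, (forall e, 0 < e -> exists2 g, D g & normsq ip (p - g) < e) &
    forall g, D g -> ip (f - p) g = 0.
Proof.
move=> [D0 DD] Hc f.
pose A : set R := [set normsq ip (f - g) | g in D].
have A_inf : has_inf A.
  split; first by exists (normsq ip (f - 0)), 0.
  by exists 0 => _ [g _ <-]; exact: normsq_ge0.
pose m := inf A.
have mle g : D g -> m <= normsq ip (f - g).
  by move=> Dg; apply: ge_inf; [exact: A_inf.2|exists g].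
pose r n : R := 4^-1 ^+ n.
have r0 n : 0 < r n by rewrite exprn_gt0// invr_gt0.
(* With excess r n / 4, the parallelogram law and the midpoint bound give |u k - u n|^2 <= (r n + r
   k) / 2 <= r n for n <= k, the rate that [ip_complete] asks for. *)
have ex n : exists g, D g /\ normsq ip (f - g) < m + r n / 4.
  have [|_ [g Dg <-] ?] := @inf_adherent _ A (r n / 4) _ A_inf.
    by rewrite divr_gt0.
  by exists g.
have {ex}[u uP] := choice ex.
have Du n : D (u n) := (uP n).1.
have Dmid g h : D g -> D h -> D (2^-1 *: (g + h)).
  move=> Dg Dh; rewrite -[_ *: _]addr0; apply: (DD) => //.
  by rewrite -[g]scale1r; exact: DD.
have [n k nk|p [C pP]] := Hc u.
  have rk : r k <= r n by rewrite /r ler_wiXn2l// ?invr_ge0// invf_le1 ?ler1n.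
  have := mle _ (Dmid _ _ (Du n) (Du k)).
  have := (uP n).2; have := (uP k).2; rewrite -/(r n) /normsq.
  rewrite !ipBl !ipBr !ipZl !ipZr !ipDl !ipDr.
  rewrite (ipC ipP (u k) (u n)) (ipC ipP (u k) f) (ipC ipP (u n) f).
  by move=> *; lra.
have Cge0 : 0 <= C.
  by rewrite (le_trans (normsq_ge0 _) (le_trans (pP 0%N) _))// mulr1.
exists p => [e e0|g Dg].
  have [n _ ne] := expr4V_lt C e0.
  by exists (u n) => //; rewrite normsqB (le_lt_trans (pP n)).
(* Split f - p as (f - u n) + (u n - p): near-minimality of [u n] controls the first term,
   convergence the second. The factor 4 covers 2 (1/4) + 2. *)
apply: (@sqr_eps0 _ _ (4 * normsq ip g)) => e e0.
have [n ne nCe] := expr4V_lt C e0.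
have fu : ip (f - u n) g ^+ 2 <= r n / 4 * normsq ip g.
  have [g0|g0] := eqVneq (normsq ip g) 0.
    by rewrite (ipC ipP) (normsq_eq0 _ g0) g0 expr0n mulr0.
  have g1 : 0 < normsq ip g by rewrite lt_neqAle eq_sym g0 normsq_ge0.
  (* Moving [u n] by this multiple of [g] lowers the squared distance the most; it cannot fall below
     [m], so the gain is less than r n / 4. *)
  pose t := ip (f - u n) g / normsq ip g.
  have : m <= normsq ip (f - (t *: g + u n)) by apply/mle/DD.
  have -> : normsq ip (f - (t *: g + u n)) =
      normsq ip (f - u n) - ip (f - u n) g ^+ 2 / normsq ip g.
    have -> : f - (t *: g + u n) = (f - u n) - t *: g.
      by rewrite opprD addrA addrAC.
    rewrite /t; move: (f - u n) => w.
    move: g0; rewrite /normsq !ipBl !ipBr !ipZl !ipZr (ipC ipP g w) => g0.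
    by field.
  move=> h; have := (uP n).2; rewrite -/(r n) => h'.
  by rewrite -ler_pdivrMr//; lra.
have up : ip (u n - p) g ^+ 2 <= C * r n * normsq ip g.
  by apply: (le_trans (ip_cs _ _)); rewrite ler_wpM2r ?normsq_ge0.
have -> : f - p = (f - u n) + (u n - p) by rewrite addrA subrK.
rewrite ipDl.
have : (ip (f - u n) g + ip (u n - p) g) ^+ 2 <=
  2 * ip (f - u n) g ^+ 2 + 2 * ip (u n - p) g ^+ 2.
  by have := sqr_ge0 (ip (f - u n) g - ip (u n - p) g); lra.
have : r n * normsq ip g <= e * normsq ip g.
  by rewrite ler_wpM2r ?normsq_ge0// ltW.
have : C * r n * normsq ip g <= e * normsq ip g.
  by rewrite ler_wpM2r ?normsq_ge0// ltW.
have := mulr_ge0 (ltW e0) (normsq_ge0 g).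
by lra.
Qed.

End theory.
End semi_inner_product.

(** * Von Neumann's theorem *)

Section von_neumann.
Context {R : realType} {H K : lmodType R}.
Context {ipH : H -> H -> R} {ipK : K -> K -> R}.
Hypotheses (HP : semi_ip ipH) (KP : semi_ip ipK).

(** The direct sum of H and K, in which graphs of operators live. *)
Definition ip_prod (p q : H * K) : R := ipH p.1 q.1 + ipK p.2 q.2.

Lemma semi_ip_prod : semi_ip ip_prod.
Proof.
split=> [f g|k f g h|f]; rewrite /ip_prod.
- by rewrite (ipC HP) (ipC KP).
- by rewrite /= (ipPl HP) (ipPl KP); ring.
- by rewrite addr_ge0// ?(ip_ge0 HP)// (ip_ge0 KP).
Qed.

Lemma ip_complete_prod : ip_complete ipH -> ip_complete ipK ->
  ip_complete ip_prod.
Proof.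
move=> HC KC u uC.
have [n m nm|l [C lC]] := HC (fst \o u).
  by apply: le_trans (uC n m nm); rewrite lerDl (normsq_ge0 KP).
have [n m nm|k [C' kC]] := KC (snd \o u).
  by apply: le_trans (uC n m nm); rewrite lerDr (normsq_ge0 HP).
by exists (l, k), (C + C') => n; rewrite mulrDl; exact: lerD (lC n) (kC n).
Qed.

Context {T : set (H * K)}.
Hypothesis Tsub : lin_subspace T.
Let Tbar := oclosure ipH ipK T.
Let Tstar := oadjoint ipH ipK T.

(** Both sides are continuous for the graph norm, so the adjoint relation passes from [T] to its
    closure. *)
Lemma oadjoint_closure f c c' g : Tbar (f, c) -> Tstar (c', g) ->
  ipK c c' = ipH f g.
Proof.
move=> Tf Tc; apply/eqP; rewrite -subr_eq0; apply/eqP.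
apply: (@sqr_eps0 _ _ (2 * normsq ipK c' + 2 * normsq ipH g)) => e e0.
have [[f0 c0] Tf0 /= [fe ce]] := Tf e e0.
have -> : ipK c c' - ipH f g = ipK (c - c0) c' - ipH (f - f0) g.
  by rewrite (ipBl KP) (ipBl HP) (Tc _ _ Tf0)/=; ring.
have := sqr_ge0 (ipK (c - c0) c' + ipH (f - f0) g).
have := ip_cs HP (f - f0) g; have := ip_cs KP (c - c0) c'.
have := ler_wpM2r (normsq_ge0 HP g) (ltW fe).
have := ler_wpM2r (normsq_ge0 KP c') (ltW ce).
by move=> *; lra.
Qed.

Lemma subspace_oclosure : lin_subspace Tbar.
Proof.
split.
  move=> e e0; exists 0; first exact: Tsub.1.
  by rewrite !subr0 /normsq (ip0l HP) (ip0l KP).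
move=> k [f c] [f' c'] Tf Tf' e e0.
(* The divisor comes from |k x + y|^2 <= 2 k^2 |x|^2 + 2 |y|^2. *)
have k0 : 0 < 2 * k ^+ 2 + 2 by have := sqr_ge0 k; lra.
have d0 : 0 < e / (2 * k ^+ 2 + 2) by rewrite divr_gt0.
have [[g b] Tg /= [fg cb]] := Tf _ d0.
have [[g' b'] Tg' /= [fg' cb']] := Tf' _ d0.
exists (k *: (g, b) + (g', b')); first exact: Tsub.2.
have aux (M : lmodType R) (ip : M -> M -> R) (x y x' y' : M) : semi_ip ip ->
    normsq ip (x - y) < e / (2 * k ^+ 2 + 2) ->
    normsq ip (x' - y') < e / (2 * k ^+ 2 + 2) ->
    normsq ip (k *: x + x' - (k *: y + y')) < e.
  move=> P xy xy'.
  have -> : k *: x + x' - (k *: y + y') = k *: (x - y) + (x' - y').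
    by rewrite scalerBr opprD addrACA.
  apply: (le_lt_trans (normsqD_le P _ _)).
  rewrite {1}/normsq (ipZl P) (ipZr P) -/(normsq _ _).
  have /(ler_wpM2l (sqr_ge0 k)) := ltW xy.
  move: xy'; set d := e / _ => xy' xy''.
  have <- : d * (2 * k ^+ 2 + 2) = e by rewrite /d divfK// gt_eqF.
  by lra.
by split; apply: aux.
Qed.

Lemma subspace_oadjoint : lin_subspace Tstar.
Proof.
split=> [f c _|k [c g] [c' g'] Tc Tc' f0 c0 T0] /=.
  by rewrite (ipC KP) (ip0l KP) (ipC HP) (ip0l HP).
rewrite (ipDr KP) (ipZr KP) (ipDr HP) (ipZr HP).
by rewrite (Tc _ _ T0) (Tc' _ _ T0).
Qed.

Let S := (Tstar \; Tbar)%relation.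

Lemma subspace_comp : lin_subspace S.
Proof.
split.
  by exists 0; [exact: subspace_oclosure.1|exact: subspace_oadjoint.1].
move=> k [f g] [f' g'] [c /= fc cg] [c' /= fc' cg'].
exists (k *: c + c').
  exact: (subspace_oclosure.2 k (f, c) (f', c')).
exact: (subspace_oadjoint.2 k (c, g) (c', g')).
Qed.

(** Both sides are the inner product in K of the intermediate values [c] and [c']. *)
Lemma comp_sym f g f' g' : S (f, g) -> S (f', g') -> ipH g f' = ipH f g'.
Proof.
move=> [c /= fc cg] [c' /= fc' cg'].
rewrite -(oadjoint_closure fc cg') (ipC HP) -(oadjoint_closure fc' cg).
exact: (ipC KP).
Qed.

Hypotheses (HC : ip_complete ipH) (KC : ip_complete ipK).

(* The projection of (h, 0) onto the closed graph of T is (f, c) with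
   (h - f, - c) orthogonal to the graph, i.e. T* c = h - f. *)
Lemma comp_resolvent h : exists f, S (f, h - f).
Proof.
have [[f c] fc orth] := projection semi_ip_prod Tsub
  (ip_complete_prod HC KC) (h, 0).
exists f; exists c => /=.
  move=> e /fc[q Tq]; rewrite {1}/normsq /ip_prod/= => qe.
  exists q => //=; split; apply: le_lt_trans qe.
    by rewrite lerDl (ip_ge0 KP).
  by rewrite lerDr (ip_ge0 HP).
move=> f0 c0 /orth; rewrite /ip_prod/= (ipBl KP) (ip0l KP) (ipC HP) (ipC KP c).
by move=> *; lra.
Qed.

(** Since 1 + S is onto, a vector orthogonal to the domain of S, or a pair of the adjoint, can be
    compared with a solution of the resolvent equation. *)
Lemma selfadjoint_comp : dense_in ipH (odom T) -> selfadjoint ipH S.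
Proof.
move=> Tdense; split.
  move=> x e e0.
  have Ssub : lin_subspace (odom S).
    split; first by exists 0; exact: subspace_comp.1.
    move=> k f f' [g fg] [g' fg']; exists (k *: g + g').
    exact: (subspace_comp.2 k (f, g) (f', g')).
  have [y yS yorth] := projection HP Ssub HC x.
  (* Solve x - y = f + S f. Orthogonality to [f] reads |f|^2 + |c|^2 = 0 with c = T f, so [f] and
     [c] are null. Then g = T^* c is orthogonal to the dense domain of T, hence null. *)
  have xy : normsq ipH (x - y) = 0.
    have [f Sf] := comp_resolvent (x - y).
    have := yorth f (ex_intro (fun g => S (f, g)) _ Sf).
    case: Sf; set g := x - y - f => c /= fc cg.
    have -> : x - y = f + g by rewrite [RHS]addrC subrK.
    rewrite (ipDl HP) (ipC HP g) -(oadjoint_closure fc cg).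
    have := ip_ge0 HP f; have := ip_ge0 KP c => cc0 ff0 fc0.
    have f0 : normsq ipH f = 0 by rewrite /normsq; lra.
    have c0 : normsq ipK c = 0 by rewrite /normsq; lra.
    have g0 : normsq ipH g = 0.
      apply: (dense_orth HP Tdense) => f1 [c1 fc1].
      by rewrite (ipC HP) -(cg _ _ fc1)/= (ipC KP) (normsq_eq0 KP).
    apply/eqP; rewrite eq_le (normsq_ge0 HP) andbT.
    by have := normsqD_le HP f g; rewrite f0 g0; lra.
  have [z Sz yz] := yS (e / 2) (divr_gt0 e0 (ltr0Sn R 1)).
  exists z => //; rewrite -(subrK y x) -addrA.
  apply: (le_lt_trans (normsqD_le HP _ _)); rewrite xy.
  by lra.
apply/seteqP; split=> [[f g] Sf|[f' g'] Sf f g Sfg] /=; last first.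
  exact: comp_sym.
(* The solution [f'] of f' + S f' = f + g must agree with [f]: the difference f - f' is orthogonal
   to the range of 1 + S, in particular to itself, written as h + S h. *)
have [f' Sf'] := comp_resolvent (f + g).
have ff' : heq ipH f f'.
  have [h Sh] := comp_resolvent (f - f').
  have := Sf _ _ Sh; have := comp_sym Sh Sf'.
  rewrite /heq /normsq /= !(ipBl HP) !(ipBr HP) !(ipDr HP).
  rewrite (ipC HP f' f) (ipC HP h f) (ipC HP h f').
  by move=> *; lra.
(* The intermediate value of [f'] serves for [f], because closure and adjoint do not distinguish
   vectors with null difference. *)
case: Sf' => c /= fc cg; exists c => /=.
  move=> e /fc[[f0 c0] T0 /= [fe ce]]; exists (f0, c0) => //=; split => //.
  rewrite (heq_normsq (g := f' - f0) HP)//.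
  by rewrite /heq opprB addrA subrK.
move=> f0 c0 T0 /=; rewrite (cg _ _ T0)/= !(ipBr HP) (ipDr HP).
by rewrite !(ipC HP f0) (heq_ip HP _ ff') addrAC subrr add0r.
Qed.

End von_neumann.

(** * The sequence space l2 *)

Section esum_real.
Context {R : realType} {V : choiceType}.
Implicit Types (a b : V -> R).

Definition rsummable a : Prop := summable [set: V] (fun x => (a x)%:E).

Lemma summable_ge0 a : (forall x, 0 <= a x) ->
  rsummable a <-> (\esum_(x in [set: V]) (a x)%:E < +oo)%E.
Proof.
move=> a0; rewrite /rsummable /summable.
rewrite (@eq_esum _ _ _ _ (fun x => (a x)%:E))//.
by move=> x _; rewrite /= ger0_norm.
Qed.

Lemma rsummable_le a b : (forall x, `|a x| <= `|b x|) ->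
  rsummable b -> rsummable a.
Proof.
by move=> ab; apply: le_lt_trans; apply: le_esum => x _; rewrite lee_fin.
Qed.

Lemma rsummableD a b : rsummable a -> rsummable b ->
  rsummable (fun x => a x + b x).
Proof. by move=> sa sb; exact: summableD sa sb. Qed.

(** Finite sums give one inequality for every nonnegative factor; applied to k^-1 it gives the
    other. *)
Lemma esumZ k a : 0 <= k -> (forall x, 0 <= a x) ->
  (\esum_(x in [set: V]) (k * a x)%:E =
   k%:E * \esum_(x in [set: V]) (a x)%:E)%E.
Proof.
move=> k0 a0.
have le_k l b : 0 <= l -> (forall x, 0 <= b x) ->
    (\esum_(x in [set: V]) (l * b x)%:E <=
     l%:E * \esum_(x in [set: V]) (b x)%:E)%E.
  move=> l0 b0; apply: ge_ereal_sup => _ [F FV <-].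
  under eq_fsbigr do rewrite EFinM.
  rewrite -ge0_mule_fsumr => [|i]; last by rewrite lee_fin.
  by apply: lee_wpmul2l => //; apply: ereal_sup_ubound; exists F.
apply/eqP; rewrite eq_le le_k//=.
have [->|kn0] := eqVneq k 0.
  by rewrite mul0e; apply: esum_ge0 => x _; rewrite mul0r.
have {kn0}k0 : 0 < k by rewrite lt_neqAle eq_sym kn0.
rewrite -lee_pdivlMl//.
apply: le_trans (le_k k^-1 (fun x => k * a x) _ _).
- by apply: le_esum => x _; rewrite mulKf ?gt_eqF.
- by rewrite invr_ge0 ltW.
- by move=> x; rewrite mulr_ge0// ltW.
Qed.

Lemma rsummableZ k a : rsummable a -> rsummable (fun x => k * a x).
Proof.
rewrite /rsummable /summable => sa.
rewrite (@eq_esum _ _ _ _ (fun x => (`|k| * `|a x|)%:E)); last first.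
  by move=> x _; rewrite /= normrM.
by rewrite esumZ// lte_mul_pinfty// fin_numE.
Qed.

Lemma esum_fin_num a : (forall x, 0 <= a x) -> rsummable a ->
  (\esum_(x in [set: V]) (a x)%:E)%E \is a fin_num.
Proof.
move=> a0 /(summable_ge0 a0) sa; rewrite ge0_fin_numE// esum_ge0// => x _.
by rewrite lee_fin.
Qed.

(** Any splitting into nonnegative summable parts computes [rsum], not only the canonical one of its
    definition. Linearity follows, since sums of positive parts are rarely positive parts. *)
Lemma rsumB a b : (forall x, 0 <= a x) -> (forall x, 0 <= b x) ->
  rsummable a -> rsummable b ->
  rsum (fun x => a x - b x) = fine (\esum_(x in [set: V]) (a x)%:E)%E -
                              fine (\esum_(x in [set: V]) (b x)%:E)%E.
Proof.
move=> a0 b0 sa sb.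
have := @esumB _ _ [set: V] _ _ sa sb (fun x _ => a0 x) (fun x _ => b0 x).
have sab : rsummable (fun x => a x - b x) by exact: summableB sa sb.
have -> : (\esum_(x in [set: V]) (fun x => (a x)%:E - (b x)%:E)^\+ x =
  \esum_(x in [set: V]) (Num.max (a x - b x)%R 0)%:E)%E.
  by apply: eq_esum => x _; rewrite funeposE -EFinB EFin_max.
have -> : (\esum_(x in [set: V]) (fun x => (a x)%:E - (b x)%:E)^\- x =
  \esum_(x in [set: V]) (Num.max (- (a x - b x))%R 0)%:E)%E.
  by apply: eq_esum => x _; rewrite funenegE -EFinB EFin_max.
move/(congr1 fine); rewrite /rsum !fineB//; try exact: esum_fin_num.
- apply: esum_fin_num => [x|]; first by rewrite le_max lexx orbT.
  apply: rsummable_le sab => x; rewrite ger0_norm ?le_max ?lexx ?orbT// ge_max.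
  by rewrite ler_norm normr_ge0.
- apply: esum_fin_num => [x|]; first by rewrite le_max lexx orbT.
  apply: rsummable_le sab => x; rewrite ger0_norm ?le_max ?lexx ?orbT// ge_max.
  by rewrite normr_ge0 -normrN ler_norm.
Qed.

Lemma rsum_ge0E a : (forall x, 0 <= a x) -> rsummable a ->
  rsum a = fine (\esum_(x in [set: V]) (a x)%:E)%E.
Proof.
move=> a0 sa; transitivity (rsum (fun x => a x - 0)).
  by congr rsum; apply/funext => x; rewrite subr0.
rewrite rsumB//; last first.
  by rewrite /rsummable /summable esum1// => x _; rewrite /= normr0.
by rewrite (esum1 (fun x _ => erefl (0 : \bar R))) subr0.
Qed.

Let pos a x := Num.max (a x) 0.
Let neg a x := Num.max (- a x) 0.
Let pos_ge0 a x : 0 <= pos a x. Proof. by rewrite le_max lexx orbT. Qed.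
Let neg_ge0 a x : 0 <= neg a x. Proof. by rewrite le_max lexx orbT. Qed.
Let posneg a x : a x = pos a x - neg a x.
Proof.
by rewrite /pos /neg; case: (leP (a x) 0) => ?; case: (leP (- a x) 0) => ?; lra.
Qed.
Let pos_le a : rsummable a -> rsummable (pos a).
Proof.
by apply: rsummable_le => x; rewrite ger0_norm// ge_max ler_norm normr_ge0.
Qed.
Let neg_le a : rsummable a -> rsummable (neg a).
Proof.
apply: rsummable_le => x; rewrite ger0_norm// ge_max normr_ge0.
by rewrite -normrN ler_norm.
Qed.

Let fine_esumD a b : (forall x, 0 <= a x) -> (forall x, 0 <= b x) ->
  rsummable a -> rsummable b ->
  fine (\esum_(x in [set: V]) (a x + b x)%:E)%E =
  fine (\esum_(x in [set: V]) (a x)%:E)%E +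
  fine (\esum_(x in [set: V]) (b x)%:E)%E.
Proof.
move=> a0 b0 sa sb; rewrite -fineD ?esum_fin_num//; congr fine.
by rewrite -esumD// => x _; rewrite lee_fin.
Qed.

Lemma rsumD a b : rsummable a -> rsummable b ->
  rsum (fun x => a x + b x) = rsum a + rsum b.
Proof.
move=> sa sb.
have -> : (fun x => a x + b x) =
    (fun x => (pos a x + pos b x) - (neg a x + neg b x)).
  by apply/funext => x; rewrite (posneg a) (posneg b); ring.
rewrite rsumB; last 4 first.
- by move=> x; rewrite addr_ge0.
- by move=> x; rewrite addr_ge0.
- by apply: rsummableD; exact: pos_le.
- by apply: rsummableD; exact: neg_le.
rewrite (fine_esumD (pos_ge0 a) (pos_ge0 b) (pos_le sa) (pos_le sb)).
rewrite (fine_esumD (neg_ge0 a) (neg_ge0 b) (neg_le sa) (neg_le sb)).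
rewrite /rsum -!/(pos _ _) -!/(neg _ _).
by rewrite opprD addrACA.
Qed.

Lemma rsumN a : rsum (fun x => - a x) = - rsum a.
Proof.
rewrite /rsum opprB; congr (_ - fine _).
by apply: eq_esum => x _; rewrite opprK.
Qed.

Lemma rsumZ k a : rsummable a -> rsum (fun x => k * a x) = k * rsum a.
Proof.
wlog k0 : k / 0 <= k => [hw|] sa.
  have [k0|/ltW k0] := leP 0 k; first exact: hw.
  rewrite -[k]opprK mulNr -hw ?oppr_ge0// -rsumN.
  by congr rsum; apply/funext => x; rewrite mulNr.
have -> : (fun x => k * a x) = (fun x => k * pos a x - k * neg a x).
  by apply/funext => x; rewrite (posneg a); ring.
rewrite rsumB; last 4 first.
- by move=> x; rewrite mulr_ge0.
- by move=> x; rewrite mulr_ge0.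
- exact/rsummableZ/pos_le.
- exact/rsummableZ/neg_le.
rewrite !esumZ// !fineM//; first by rewrite /rsum mulrBr.
  exact/esum_fin_num/neg_le.
exact/esum_fin_num/pos_le.
Qed.

Lemma esum_le_fin (a : V -> R) (M : R) : (forall x, 0 <= a x) ->
  (forall F, finite_set F -> \sum_(x \in F) a x <= M) ->
  (\esum_(x in [set: V]) (a x)%:E <= M%:E)%E.
Proof.
move=> a0 aM; apply: ge_ereal_sup => _ [F [Ff _] <-].
by rewrite fsumEFin// lee_fin aM.
Qed.

Lemma fin_le_rsum (a : V -> R) F : (forall x, 0 <= a x) -> rsummable a ->
  finite_set F -> \sum_(x \in F) a x <= rsum a.
Proof.
move=> a0 sa Ff; rewrite -lee_fin rsum_ge0E// fineK ?esum_fin_num//.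
by rewrite -fsumEFin//; apply: ereal_sup_ubound; exists F.
Qed.

End esum_real.

(** * Inner product and completeness of l2 *)

Section l2_space.
Context {R : realType} {V : choiceType}.
Implicit Types c e : l2 R V.

Lemma l2_summable c : rsummable (fun x => c x ^+ 2).
Proof.
have /= := l2_valP c; rewrite inE/= => h.
apply/summable_ge0 => [x|]; first exact: sqr_ge0.
by under eq_esum do rewrite -[_ ^+ 2]real_normK ?num_real//.
Qed.

Lemma l2_mul_summable c e : rsummable (fun x => c x * e x).
Proof.
apply: (rsummable_le _ (rsummableD (l2_summable c) (l2_summable e))) => x.
rewrite [leRHS]ger0_norm ?addr_ge0 ?sqr_ge0// ler_norml.
have := sqr_ge0 (c x + e x); have := sqr_ge0 (c x - e x).
by have := sqr_ge0 (c x); have := sqr_ge0 (e x) => *; apply/andP; split; lra.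
Qed.

Lemma semi_ip_l2 : semi_ip (@l2_ip R V).
Proof.
split=> [f g|k f g h|f]; rewrite /l2_ip.
- by congr rsum; apply/funext => x; rewrite mulrC.
- have -> : (fun x => (k *: f + g) x * h x) =
            (fun x => k * (f x * h x) + g x * h x).
    by apply/funext => x; rewrite mulrA -mulrDl.
  have sfh := l2_mul_summable f h.
  by rewrite rsumD ?rsumZ//; [exact: rsummableZ|exact: l2_mul_summable].
- rewrite rsum_ge0E.
  + rewrite fine_ge0// esum_ge0// => x _.
    by rewrite lee_fin -expr2 sqr_ge0.
  + by move=> x; rewrite -expr2 sqr_ge0.
  + exact: l2_mul_summable.
Qed.

Lemma l2_normsqE c :
  ((normsq l2_ip c)%:E = \esum_(x in [set: V]) (`|c x| ^+ 2)%:E)%E.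
Proof.
rewrite /normsq /l2_ip (rsum_ge0E _ (l2_mul_summable c c)) => [|x]; last first.
  by rewrite -expr2 sqr_ge0.
rewrite fineK ?esum_fin_num//; last 2 first.
- by move=> x; rewrite -expr2 sqr_ge0.
- exact: l2_mul_summable.
by apply: eq_esum => x _; rewrite real_normK ?num_real// expr2.
Qed.

Lemma l2_fin_le c F : finite_set F ->
  \sum_(x \in F) c x ^+ 2 <= normsq l2_ip c.
Proof.
by move=> Ff; exact: (fin_le_rsum (fun x => sqr_ge0 (c x)) (l2_summable c)).
Qed.

Lemma l2_coord_le c x : c x ^+ 2 <= normsq l2_ip c.
Proof. by have := l2_fin_le c (finite_set1 x); rewrite fsbig_set1. Qed.

(** The limit is taken coordinatewise; the Cauchy bound on each finite set of coordinates passes to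
    the limit, then to the supremum over finite sets. *)
Lemma ip_complete_l2 : ip_complete (@l2_ip R V).
Proof.
move=> u uC.
have ux x : cvgn (fun n => u n x).
  apply: fast_cauchy_cvg => n m nm; apply: le_trans (uC n m nm).
  exact: (l2_coord_le (u m - u n)).
pose l x := limn (fun n => u n x).
have lF n F : finite_set F -> \sum_(x \in F) (l x - u n x) ^+ 2 <= 4^-1 ^+ n.
  move=> Ff; rewrite fsbig_finite//=.
  have : (fun m => \sum_(x <- fset_set F) (u m x - u n x) ^+ 2) @ \oo -->
         \sum_(x <- fset_set F) (l x - u n x) ^+ 2.
    elim: (enum_fset (fset_set F)) => [|x s ih].
      by under eq_fun do rewrite big_nil; rewrite big_nil; exact: cvg_cst.
    under eq_fun do rewrite big_cons; rewrite big_cons.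
    apply: cvgD ih; rewrite expr2; under eq_fun do rewrite expr2.
    have uxn : (fun m => u m x - u n x) @ \oo --> l x - u n x.
      by apply: cvgB; [exact: ux|exact: cvg_cst].
    exact: cvgM.
  move/cvgr_to_le; apply; exists n => // m /= nm.
  rewrite -(fsbig_finite _ _ Ff); apply: le_trans (uC n m nm).
  exact: (l2_fin_le (u m - u n)).
(* The bound controls [l - u 0] and not [l], so the limit is built as [u 0] plus this difference. *)
have d0P : (fun x => l x - u 0%N x) \in @l2_pred R V.
  rewrite inE/=; apply: (@le_lt_trans _ _ (4^-1 ^+ 0)%:E); last exact: ltry.
  apply: esum_le_fin => [x|F Ff]; first exact: exprn_ge0.
  apply: le_trans (lF 0%N F Ff); rewrite le_eqVlt; apply/predU1P; left.
  by apply: eq_fsbigr => x _; rewrite real_normK ?num_real.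
exists (u 0%N + L2 d0P), 1 => n; rewrite mul1r -lee_fin l2_normsqE.
apply: esum_le_fin => [x|F Ff]; first exact: exprn_ge0.
apply: le_trans (lF n F Ff); rewrite le_eqVlt; apply/predU1P; left.
apply: eq_fsbigr => x _; rewrite real_normK ?num_real//.
have -> : (u n - (u 0%N + L2 d0P)) x =
  u n x - (u 0%N x + (l x - u 0%N x)) by [].
by rewrite [_ + (_ - _)]addrC subrK -sqrrN opprB.
Qed.

End l2_space.

(** * Completeness of L2 *)

Section L2_space.
Context {d : measure_display} {Omega : measurableType d} {R : realType}.
Context {P : probability Omega R}.
Implicit Types f g h : L2rv P.

Lemma L2_integrable f g : P.-integrable [set: Omega] (fun w => (f w * g w)%:E).
Proof. exact/Lfun1_integrable/(Lfun2_mul_Lfun1 (LfunP f) (LfunP g)). Qed.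

Lemma L2_ipE f g : ((L2_ip f g)%:E = \int[P]_w (f w * g w)%:E)%E.
Proof.
rewrite /L2_ip unlock fineK//; apply: integrable_fin_num => //.
exact: L2_integrable.
Qed.

Lemma semi_ip_L2 : semi_ip (@L2_ip _ _ _ P).
Proof.
split=> [f g|k f g h|f].
- by rewrite /L2_ip; under eq_fun do rewrite mulrC.
- apply: EFin_inj; rewrite (EFinD (k * _)) (EFinM k) !L2_ipE.
  rewrite -integralZl//; last exact: L2_integrable.
  rewrite -integralD//; last 2 first.
  + by apply: integrableZl => //; exact: L2_integrable.
  + exact: L2_integrable.
  apply: eq_integral => w _; rewrite -EFinM -EFinD; congr EFin.
  by rewrite mulrA -mulrDl.
- rewrite -lee_fin L2_ipE integral_ge0// => w _.
  by rewrite lee_fin -expr2 sqr_ge0.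
Qed.

Lemma L2_normsqE f :
  ((normsq (@L2_ip _ _ _ P) f)%:E = \int[P]_w (f w ^+ 2)%:E)%E.
Proof. by rewrite /normsq L2_ipE; under eq_integral do rewrite -expr2. Qed.

Lemma Lfun2P (f : Omega -> R) : measurable_fun [set: Omega] f ->
  (\int[P]_w (f w ^+ 2)%:E < +oo)%E -> f \in Lfun P 2%:E.
Proof.
move=> mf foo; apply/andP; split; rewrite inE//=.
rewrite /finite_norm unlock/= poweR_lty//.
by under eq_integral do rewrite powR_mulrn// real_normK ?num_real//.
Qed.

(** Riesz-Fischer: the increments have summable L1 norms, so the sequence converges almost surely,
    and Fatou's lemma turns the Cauchy bound into norm convergence. *)
Lemma ip_complete_L2 : ip_complete (@L2_ip _ _ _ P).
Proof.
move=> u uC.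
have mu n : measurable_fun [set: Omega] (u n) by [].
pose D k w := u k.+1 w - u k w.
have mD k : measurable_fun [set: Omega] (D k) by exact: measurable_funB.
(* The bound is 2^-k, in the shape that [epsilon_trick0] sums to 2. *)
have Dle k : (\int[P]_w `|D k w|%:E <= (2 / (2 ^ k.+1)%:R)%:E)%E.
  pose c : R := 2 ^+ k.
  have c0 : 0 < c by rewrite exprn_gt0.
  have mD2 : measurable_fun [set: Omega]
      (fun w => (c / 2)%:E * (D k w ^+ 2)%:E)%E.
    by apply: measurable_funeM; exact/measurable_EFinP/measurable_funX.
  (* AM-GM: 2 |D| <= c D^2 + 1 / c *)
  apply: (@le_trans _ _
    (\int[P]_w ((c / 2)%:E * (D k w ^+ 2)%:E + (c^-1 / 2)%:E))%E).
    apply: ge0_le_integral => //=.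
    - exact/measurable_EFinP/measurableT_comp.
    - exact: (emeasurable_funD mD2 (measurable_cst _)).
    - move=> w _; rewrite -EFinM -EFinD lee_fin.
      have := sqr_ge0 (c * `|D k w| - 1).
      rewrite sqrrB1 exprMn real_normK ?num_real// => h.
      rewrite -(ler_pM2l c0) mulrDr !mulrA mulfV ?gt_eqF//.
      by rewrite -expr2; move: h; rewrite mulr2n; lra.
  rewrite ge0_integralD//; last 2 first.
  - by move=> w _; rewrite mule_ge0// lee_fin ?sqr_ge0// divr_ge0// ltW.
  - by move=> w _; rewrite lee_fin divr_ge0// invr_ge0 ltW.
  rewrite [X in (_ + X <= _)%E](integral_cst P measurableT (c^-1 / 2)%:E).
  rewrite [X in (_ + _ * X <= _)%E](_ : _ = 1%E) ?mule1; last first.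
    exact: probability_setT.
  rewrite ge0_integralZl//; last 3 first.
  - exact/measurable_EFinP/measurable_funX.
  - by move=> w _; rewrite lee_fin sqr_ge0.
  - by rewrite lee_fin divr_ge0// ltW.
  rewrite -(L2_normsqE (u k.+1 - u k)) -EFinM -EFinD lee_fin.
  have -> : 2 / (2 ^ k.+1)%:R = c^-1.
    by rewrite natrX exprS -/c invfM mulrA mulfV ?mul1r.
  have := ler_wpM2l (ltW c0) (uC k k.+1 (leqnSn k)).
  have -> : (4^-1 : R) ^+ k = c^-1 * c^-1.
    by rewrite /c -exprVn -exprMn -invfM -natrM.
  rewrite mulrA mulfV ?gt_eqF// mul1r.
  by move=> *; lra.
pose G w := (\sum_(0 <= k <oo) `|D k w|%:E)%E.
have mG : measurable_fun [set: Omega] G.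
  apply: ge0_emeasurable_sum => // k _.
  exact/measurable_EFinP/measurableT_comp.
pose A := [set w | (G w < +oo)%E].
have mA : measurable A.
  by rewrite -[A]setTI; exact: emeasurable_fun_infty_o.
have Aae : \forall w \ae P, A w.
  have : P.-integrable [set: Omega] G.
    apply/integrableP; split => //.
    under eq_integral do rewrite gee0_abs ?nneseries_ge0//.
    rewrite integral_nneseries//; last first.
      by move=> k; exact/measurable_EFinP/measurableT_comp.
    apply: (@le_lt_trans _ _ 2%:E); last exact: ltry.
    apply: le_trans (epsilon_trick0 xpredT (ler0n R 2)).
    by apply: lee_nneseries => [k _ _|k _]; [exact: integral_ge0|exact: Dle].
  move/(integrable_ae measurableT); apply: filterS => w /(_ I).
  by rewrite /A/= fin_numE ltey => /andP[].
(* Cutting off outside the full-measure set [A] gives convergence everywhere, hence a measurable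
   limit. *)
pose v n w := u n w * \1_A w.
have mv n : measurable_fun [set: Omega] (v n).
  by apply: measurable_funM => //; exact: measurable_indic.
have vcvg w : cvgn (fun n => v n w).
  have [Aw|nAw] := pselect (A w); last first.
    rewrite /v; under eq_fun do rewrite indicE memNset// mulr0.
    exact: is_cvg_cst.
  rewrite /v; under eq_fun do rewrite indicE mem_set// mulr1.
  have : cvgn (series (fun k => D k w)).
    apply: normed_cvg; apply: (@nnseries_is_cvg _ (fun k => `|D k w|)) => [k|].
      exact: normr_ge0.
    exact: Aw.
  move=> h.
  have -> : (fun n => u n w) =
      (fun n => u 0%N w + series (fun k => D k w) n).
    by apply/funext => n; rewrite (eq_sum_telescope (fun n => u n w)).
  by apply: is_cvgD => //; exact: is_cvg_cst.
pose l w := limn (fun n => v n w).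
have ml : measurable_fun [set: Omega] l.
  by apply: (measurable_fun_cvg mv) => w _; exact: vcvg.
have lu n : (\int[P]_w ((l w - u n w) ^+ 2)%:E <= (4^-1 ^+ n)%:E)%E.
  apply: (@le_trans _ _ (\int[P]_w ((l w - v n w) ^+ 2)%:E)%E).
    apply: ae_ge0_le_integral => //.
    - by move=> w _; rewrite lee_fin sqr_ge0.
    - exact/measurable_EFinP/measurable_funX/measurable_funB.
    - by move=> w _; rewrite lee_fin sqr_ge0.
    - exact/measurable_EFinP/measurable_funX/measurable_funB.
    by apply: filterS Aae => w Aw _; rewrite /v indicE mem_set// mulr1.
  (* The shift by [n] makes the Cauchy bound hold for every term of the sequence given to Fatou's
     lemma. *)
  pose f m w := ((v (m + n)%N w - v n w) ^+ 2)%:E.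
  have mf m : measurable_fun [set: Omega] (f m).
    exact/measurable_EFinP/measurable_funX/measurable_funB.
  have f0 m w : [set: Omega] w -> (0 <= f m w)%E by rewrite lee_fin sqr_ge0.
  have := fatou P measurableT mf f0.
  under eq_integral => w _.
    rewrite (_ : limn_einf _ = ((l w - v n w) ^+ 2)%:E); first over.
    apply: (cvg_limn_einf_sup _).1; apply: cvg_EFin; first exact: nearW.
    rewrite /f/=; rewrite expr2; under eq_fun do rewrite expr2.
    have vw : (fun m => v (m + n)%N w - v n w) @ \oo --> l w - v n w.
      apply: cvgB; last exact: cvg_cst.
      by rewrite (cvg_shiftn n (fun m => v m w)); exact: vcvg.
    exact: cvgM.
  move/le_trans; apply; apply: limn_einf_le => m.
  apply: (@le_trans _ _ (\int[P]_w ((u (m + n)%N - u n) w ^+ 2)%:E)%E).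
    apply: ge0_le_integral => //.
    - by move=> w _; rewrite lee_fin sqr_ge0.
    - by apply/measurable_EFinP/measurable_funX.
    move=> w _; rewrite lee_fin /v -mulrBl exprMn ler_piMr ?sqr_ge0//.
  by rewrite -L2_normsqE lee_fin uC// leq_addl.
have eP : (fun w => l w - u 0%N w) \in Lfun P 2%:E.
  apply: Lfun2P; first exact: measurable_funB.
  exact: le_lt_trans (lu 0%N) (ltry _).
exists (u 0%N + Lfun_Sub (lee1n 2) eP), 1 => n.
rewrite mul1r -lee_fin L2_normsqE; apply: le_trans (lu n).
rewrite le_eqVlt; apply/predU1P; left; apply: eq_integral => w _; congr EFin.
have -> : (u n - (u 0%N + Lfun_Sub (lee1n 2) eP)) w =
  u n w - (u 0%N w + (l w - u 0%N w)) by [].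
by rewrite [_ + (_ - _)]addrC subrK -sqrrN opprB.
Qed.

End L2_space.

(** * Spectral subspaces *)

Section bounded_integrand.
Context {d : measure_display} {T : measurableType d} {R : realType}.
Context {mu : {measure set T -> \bar R}} {X : T -> R}.
Hypothesis mX : measurable_fun [set: T] X.

Lemma ae_bounds_integral (A : set T) (a b M : R) : 0 <= a -> a <= b ->
  measurable A -> (forall t, A t -> a <= X t <= b) ->
  mu (~` A) = 0%E -> mu [set: T] = M%:E ->
  (\int[mu]_t (X t ^+ 2)%:E < +oo)%E /\
  ((a * M)%:E <= \int[mu]_t (X t)%:E <= (b * M)%:E)%E.
Proof.
move=> a0 ab mA XA muA muT.
(* Clamping [X] to [a, b] changes it only on a null set and makes the bounds hold everywhere. *)
pose g t := Num.max a (Num.min (X t) b).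
have ga t : a <= g t by rewrite le_max lexx.
have gb t : g t <= b by rewrite ge_max ab ge_min lexx orbT.
have mg : measurable_fun [set: T] g.
  by apply: measurable_maxr => //; apply: measurable_minr.
have tg : \forall t \ae mu, g t = X t.
  exists (~` A); split => //; first exact: measurableC.
  apply: subsetC => t /XA /andP[at_ tb].
  by rewrite /= /g (min_idPl tb) (max_idPr at_).
have cstE r : (\int[mu]_t r%:E = (r * M)%:E)%E.
  by rewrite (integral_cst mu measurableT r%:E) EFinM; congr (_ * _)%E.
split.
  apply: (@le_lt_trans _ _ (b ^+ 2 * M)%:E); last exact: ltry.
  rewrite -cstE; apply: ae_ge0_le_integral => //.
  - by move=> t _; rewrite lee_fin sqr_ge0.
  - exact/measurable_EFinP/measurable_funX.
  - by move=> t _; rewrite lee_fin sqr_ge0.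
  apply: filterS tg => t tE _; rewrite lee_fin -tE lerXn2r// nnegrE.
    exact: le_trans (ga t).
  exact: le_trans ab.
rewrite (@ae_eq_integral _ _ _ mu setT (EFin \o g))//=; last 3 first.
- exact/measurable_EFinP.
- exact/measurable_EFinP.
- by apply: filterS tg => t tE _; rewrite /= tE.
rewrite -!cstE; apply/andP; split; apply: ge0_le_integral => //.
- exact/measurable_EFinP.
- by move=> t _; rewrite lee_fin.
- by move=> t _; rewrite lee_fin (le_trans a0).
- exact/measurable_EFinP.
- by move=> t _; rewrite lee_fin.
Qed.

End bounded_integrand.

Section spectral_subspaces.
Context {R : realType} {H : lmodType R} {ip : H -> H -> R} (ipP : semi_ip ip).
Context {E : pvm ip}.
Let mitv a b : @measurable _ (measurableTypeR R) `[a, b].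
Proof. exact: measurable_itv. Qed.

Lemma pvm_measureT f : pvm_measure E f [set: R] = (normsq ip f)%:E.
Proof. by rewrite pvm_measureE// (heq_ip ipP _ (pvm_setT E f)). Qed.

(** Polarization on the diagonal involves [f + f]; symmetry moves the projection across, so that
    bilinearity of [ip] gives the factor 4. *)
Lemma pvm_measure_double f A : @measurable _ (measurableTypeR R) A ->
  pvm_measure E (f + f) A = (4 * ip (E A f) f)%:E.
Proof.
move=> mA; rewrite pvm_measureE//; congr EFin.
rewrite (ipDr ipP) (pvm_sym E (f + f) f mA) (ipDl ipP).
rewrite -(pvm_sym E f f mA).
by lra.
Qed.

(** By symmetry and idempotence this squared norm is the mass that the measure of [f] gives to the
    empty set. *)
Lemma pvm_set0 f : normsq ip (E set0 f) = 0.
Proof.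
have m0 : @measurable _ (measurableTypeR R) set0 by exact: measurable0.
rewrite /normsq -(pvm_sym E _ _ m0) (heq_ip ipP _ (pvm_setI E f m0 m0)) setI0.
by apply: EFin_inj; rewrite -(pvm_measureE E)// measure0.
Qed.

(** The projections of [A] and its complement compose to that of the empty set. Thus the measure of
    [f] is carried by [A]. *)
Lemma spectral_subspaceC A f : @measurable _ (measurableTypeR R) A ->
  spectral_subspace E A f -> ip (E (~` A) f) f = 0.
Proof.
move=> mA [h fh]; have mC := measurableC mA.
rewrite (ipC ipP) (heq_ip ipP _ fh) (pvm_sym E _ _ mA) (ipC ipP).
rewrite (heq_ip ipP _ (pvm_setI E f mA mC)) setICr.
exact/(normsq_eq0 ipP)/pvm_set0.
Qed.

(** A measure carried by [a, b] has finite second moment, which puts [f] in the domain. Polarization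
    with h = f then gives [ip g f] as a quarter of an integral against a measure of mass 4 |f|^2. *)
Lemma spectral_resolution_bounds (S : set (H * H)) (a b : R) f :
  spectral_resolution S E -> 0 <= a -> a <= b ->
  spectral_subspace E `[a, b] f ->
  exists2 g, S (f, g) & a * normsq ip f <= ip g f <= b * normsq ip f.
Proof.
move=> [domS SE] a0 ab fE.
have mX : measurable_fun [set: measurableTypeR R]
    (fun t : measurableTypeR R => t : R).
  exact: measurable_id.
have itvP (t : measurableTypeR R) : `[a, b]%classic t -> a <= t <= b.
  by rewrite /= in_itv.
have f0 := spectral_subspaceC (mitv a b) fE.
have mC := measurableC (mitv a b).
have [t2 _] := ae_bounds_integral mX a0 ab (mitv a b) itvP
  (etrans (pvm_measureE E f mC) (congr1 EFin f0)) (pvm_measureT f).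
have /domS[g Sfg] := t2.
exists g => //; have Sf : odom S f by exists g.
have := SE _ _ _ Sfg Sf; rewrite subrr.
(* The other polarization term has f - f = 0; its measure has mass 0, so both bounds force a zero
   integral. *)
have z0 : pvm_measure E 0 (~` `[a, b]) = 0%E.
  by rewrite pvm_measureE// (ipC ipP) (ip0l ipP).
have [_ ] := ae_bounds_integral mX a0 ab (mitv a b) itvP z0 (pvm_measureT 0).
rewrite /normsq (ip0l ipP) !mulr0 -eq_le => /eqP <-; rewrite sube0.
have d0 : pvm_measure E (f + f) (~` `[a, b]) = 0%E.
  by rewrite pvm_measure_double// f0 mulr0.
have [_ /andP[]] :=
  ae_bounds_integral mX a0 ab (mitv a b) itvP d0 (pvm_measureT (f + f)).
rewrite /normsq !(ipDr ipP) !(ipDl ipP) => aI bI.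
have Ifin : (\int[pvm_measure E (f + f)]_t t%:E)%E \is a fin_num.
  by rewrite fin_numElt (lt_le_trans _ aI) ?ltNyr// (le_lt_trans bI) ?ltry.
move: aI bI; rewrite -(fineK Ifin) -EFinM !lee_fin => aI bI [->].
by apply/andP; split; lra.
Qed.

End spectral_subspaces.

(** * The analysis operator *)

Section linear_span.
Context {R : realType} {H : lmodType R} {ip : H -> H -> R} (ipP : semi_ip ip).
Context {V : choiceType} {phi : V -> H}.

(** Lists in [lspan] may repeat indices. Absorbing multiplicities into the coefficients lets two
    combinations share one duplicate-free list. *)
Lemma sum_count_mem (s u : seq V) (a : V -> R) : uniq u -> {subset s <= u} ->
  \sum_(x <- s) a x *: phi x = \sum_(x <- u) (a x *+ count_mem x s) *: phi x.
Proof.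
move=> uu; elim: s => [|y s ih] su.
  by rewrite big_nil big1// => x _; rewrite mulr0n scale0r.
rewrite big_cons ih => [|x xs]; last by rewrite su// inE xs orbT.
have yu : y \in u by rewrite su// mem_head.
under [RHS]eq_bigr do rewrite /= mulrnDr scalerDl.
rewrite big_split/=; congr (_ + _).
rewrite (bigD1_seq y)//= eqxx mulr1n big1 ?addr0// => x /negPf xy.
by rewrite eq_sym xy mulr0n scale0r.
Qed.

Lemma lin_subspace_lspan : lin_subspace (lspan ip phi).
Proof.
split.
  exists [::], (fun=> 0).
  by rewrite /heq big_nil subr0 /normsq (ip0l ipP).
move=> k f g [s [a fa]] [t [b gb]].
pose u := undup (s ++ t).
have su : {subset s <= u} by move=> x xs; rewrite mem_undup mem_cat xs.
have tu : {subset t <= u} by move=> x xs; rewrite mem_undup mem_cat xs orbT.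
exists u, (fun x => k * (a x *+ count_mem x s) + b x *+ count_mem x t).
rewrite (sum_count_mem _ (undup_uniq _) su) in fa.
rewrite (sum_count_mem _ (undup_uniq _) tu) in gb.
under eq_bigr do rewrite scalerDl -scalerA.
rewrite big_split/= -scaler_sumr.
set F := \sum_(_ <- _) _ in fa *; set G := \sum_(_ <- _) _ in gb *.
exact: heq_lin.
Qed.

End linear_span.

Section analysis.
Context {d : measure_display} {Omega : measurableType d} {R : realType}.
Context {P : probability Omega R} {V : choiceType} {phi : V -> L2rv P}.
Local Notation ip := (@L2_ip _ _ _ P).
Let ipP : semi_ip ip := semi_ip_L2.
Let L := analysis_op phi.

Lemma lin_subspace_analysis : lin_subspace L.
Proof.
have [l0 ll] := lin_subspace_lspan (phi := phi) ipP.
split; first by split=> // x; rewrite /= (ipC ipP) (ip0l ipP).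
move=> k [f c] [g e] [/= fs fc] [/= gs ge]; split; first exact: ll.
move=> x; rewrite /= (ipDr ipP) (ipZr ipP) -fc -ge.
by [].
Qed.

(** Each coordinate and each pairing with [phi x] is continuous, so the formula for L survives the
    closure. *)
Lemma closure_analysis f c : oclosure ip l2_ip L (f, c) ->
  forall x, c x = L2_ip (phi x) f.
Proof.
move=> fc x; apply/subr0_eq/(@sqr_eps0 _ _ (2 + 2 * normsq ip (phi x))) => e e0.
have [[g b] [/= _ bE] [/= fg cb]] := fc e e0.
have -> : c x - L2_ip (phi x) f = (c - b) x - ip (phi x) (f - g).
  have -> : (c - b) x = c x - b x by [].
  by rewrite bE (ipBr ipP); ring.
have := sqr_ge0 ((c - b) x + ip (phi x) (f - g)).
have := ip_cs ipP (phi x) (f - g); have := l2_coord_le (c - b) x.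
have := ler_wpM2l (normsq_ge0 ipP (phi x)) (ltW fg).
by move=> *; lra.
Qed.

(** Square summability of the Gram matrix puts every L phi_y in l2, so L is defined on the whole
    span. *)
Lemma dense_analysis :
  (forall x,
    (\esum_(y in [set: V]) (`|L2_ip (phi x) (phi y)| ^+ 2)%:E < +oo)%E) ->
  dense_in ip (lspan ip phi) -> dense_in ip (odom L).
Proof.
move=> phi2 phid f e e0; have [g gs fg] := phid f e e0.
exists g => //.
have psiP y : (fun x => L2_ip (phi x) (phi y)) \in @l2_pred R V.
  rewrite inE/=; apply: le_lt_trans (phi2 y); apply: le_esum => x _.
  by rewrite lee_fin (ipC semi_ip_L2).
pose psi y := L2 (psiP y).
have [s [a ga]] := gs.
exists (\sum_(y <- s) a y *: psi y); split => // x /=.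
rewrite (ipC ipP) (heq_ip ipP _ ga) (ip_sum ipP).
elim: s {ga} => [|y s ih]; first by rewrite !big_nil.
rewrite !big_cons -ih (ipZl ipP) (ipC ipP (phi y)).
by [].
Qed.

End analysis.

(** * The generalized frame operator and its frame bounds *)

Theorem corollary4p2 (R : realType) (V : countType)
    (d : measure_display) (Omega : measurableType d) (P : probability Omega R)
    (phi : V -> L2rv P) (hphi : random_frame phi)
    (hdense : dense_in (@L2_ip _ _ _ P) (lspan (@L2_ip _ _ _ P) phi)) :
  let ip := @L2_ip _ _ _ P in
  let L := analysis_op phi in
  let L1 := oclosure ip l2_ip L in
  let Lstar := oadjoint ip l2_ip L in
  let S := (Lstar \; L1)%relation in
  ((forall f g, S (f, g) ->
      weak_sum ip (odom L1) (fun x => L2_ip (phi x) f) phi g) /\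
   selfadjoint ip S) /\
  (forall (a b : R) (E : pvm ip), 0 < a -> a <= b -> spectral_resolution S E ->
    forall f, spectral_subspace E `[a, b] f ->
      (a%:E * 'E_P[(fun w => `|f w| ^+ 2)%R]
         <= \esum_(x in [set: V]) (`|L2_ip (phi x) f| ^+ 2)%:E)%E /\
      (\esum_(x in [set: V]) (`|L2_ip (phi x) f| ^+ 2)%:E
         <= b%:E * 'E_P[(fun w => `|f w| ^+ 2)%R])%E).
Proof.
move=> ip L L1 Lstar S.
have HP : semi_ip ip := semi_ip_L2; have KP := @semi_ip_l2 R V.
split; first split.
(* With c = L1 f, e = L1 h and g = L^* c, both sides of the weak sum are the l2 inner product of [c]
   and [e]. *)
- move=> f g [c /= fc cg] h [e he].
  have -> : (fun x => L2_ip (phi x) f * ip (phi x) h) = (fun x => c x * e x).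
    by apply/funext => x; rewrite (closure_analysis fc) (closure_analysis he).
  split.
    have -> : (fun x => (L2_ip (phi x) f * ip (phi x) h)%:E) =
        (fun x => (c x * e x)%:E).
      by apply/funext => x; rewrite (closure_analysis fc) (closure_analysis he).
    exact: l2_mul_summable.
  by rewrite (ipC HP) -(oadjoint_closure HP KP he cg) (ipC KP).
- apply: (selfadjoint_comp HP KP (lin_subspace_analysis (phi := phi))).
  + exact: ip_complete_L2.
  + exact: ip_complete_l2.
  + exact: dense_analysis hphi.1 hdense.
move=> a b E a0 ab SE f fE.
have [g [c /= fc cg]] := spectral_resolution_bounds HP SE (ltW a0) ab fE.
(* The adjoint relation turns <L^* L1 f, f> into |L1 f|^2, the sum of the squared coefficients. *)
rewrite (ipC HP g) -(oadjoint_closure HP KP fc cg) => /andP[afc fcb].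
have -> : ('E_P[(fun w => `|f w| ^+ 2)%R] = (normsq ip f)%:E)%E.
  rewrite L2_normsqE unlock; apply: eq_integral => w _.
  by rewrite real_normK ?num_real.
have -> : (\esum_(x in [set: V]) (`|L2_ip (phi x) f| ^+ 2)%:E =
    (normsq l2_ip c)%:E)%E.
  by rewrite l2_normsqE; apply: eq_esum => x _; rewrite (closure_analysis fc).
by rewrite -!EFinM !lee_fin.
Qed.
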